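(* Let $\mathcal{E}$ be an evolution algebra over $\mathbb{K}$, and let $r\geq1$ be the number of steps until the $\mathcal{E}$-supersolvable nilpotent series $0\subseteq\mathcal{N}^1(\mathcal{E})\subseteq\mathcal{N}^2(\mathcal{E})\subseteq\cdots$ stabilises. Then $\mathcal{N}^r(\mathcal{E})$ is the largest $\mathcal{E}$-supersolvable nilpotent ideal of $\mathcal{E}$.
   Context: $\mathbb{K}$ is a field of characteristic different from $2$. An evolution algebra over $\mathbb{K}$ is a finite-dimensional $\mathbb{K}$-algebra (commutative, not necessarily associative) having a basis $B=\{e_1,\dots,e_n\}$, called a natural basis, with $e_ie_j=0$ for $i\neq j$; a natural basis $B$ of $\mathcal{E}$ is fixed. For $u=\sum\mu_ie_i$, $\operatorname{supp}(u)=\{i:\mu_i\neq0\}$, and for a subspace $U$, $\operatorname{supp}(U)=\bigcup_{u\in U}\operatorname{supp}(u)$. $\operatorname{ann}(\mathcal{A})=\{u\in\mathcal{A}: u\mathcal{A}=0\}$. For an algebra $\mathcal{A}$ put $\mathcal{A}^1=\mathcal{A}$, $\mathcal{A}^{m+1}=\sum_{i=1}^m\mathcal{A}^i\mathcal{A}^{m+1-i}$, and $\mathcal{A}^{(1)}=\mathcal{A}$, $\mathcal{A}^{(m+1)}=\mathcal{A}^{(m)}\mathcal{A}^{(m)}$; $\mathcal{A}$ is nilpotent (solvable) if $\mathcal{A}^m=0$ (resp. $\mathcal{A}^{(m)}=0$) for some $m$; $\mathcal{A}^2$ is the derived subalgebra; an ideal is nilpotent if it is so as an algebra, and an ideal $I$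 is abelian if $I^2=0$. An ideal $I$ of $\mathcal{E}$ is $\mathcal{E}$-supersolvable if there is a chain $0=I_0\subsetneq I_1\subsetneq\dots\subsetneq I_s=I$ with each $I_i$ an ideal of $\mathcal{E}$ and $\dim I_i=i$. $\mathcal{T}_{\mathbb{K}}$ is the class of solvable, non-nilpotent evolution algebras over $\mathbb{K}$ with one-dimensional derived subalgebra; every $\mathcal{A}\in\mathcal{T}_{\mathbb{K}}$ has a unique maximal nilpotent ideal, denoted $\operatorname{Nil}(\mathcal{A})$. The $\mathcal{E}$-supersolvable nilpotent series is defined inductively, with $\mathcal{N}^0(\mathcal{E})=0$. Given the ideal $\mathcal{N}^{i-1}=\mathcal{N}^{i-1}(\mathcal{E})$, $i\ge1$, consider all ideals of $\mathcal{E}$ of the form $J=\operatorname{span}\{w\}+\mathcal{N}^{i-1}$ of dimension $1+\dim\mathcal{N}^{i-1}$ with $w^2\in\mathcal{N}^{i-1}$ and $\operatorname{supp}(w)\cap\operatorname{supp}(\mathcal{N}^{i-1})=\emptyset$ (for $i=1$ these are exactly the one-dimensional abelian ideals of $\mathcal{E}$). Then $\overline{J}=J/\mathcal{N}^{i-1}$ is a one-dimensional abelian ideal of the evolution algebra $\mathcal{E}/\mathcal{N}^{i-1}$, and either (a) $\overline{J}\subseteq\operatorname{ann}(\mathcal{E}/\mathcal{N}^{i-1})$, or (b) $\overline{J}$ is the derived subalgebra of the ideal $\mathcal{E}_J=\operatorname{span}\{\overline{e_k}: k\in\operatorname{supp}(w)\}$ of $\mathcal{E}/\mathcal{N}^{i-1}$,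 with $\mathcal{E}_J\in\mathcal{T}_{\mathbb{K}}$. The ideal $\mathcal{N}^i(\mathcal{E})\supseteq\mathcal{N}^{i-1}$ is defined by $$\mathcal{N}^i(\mathcal{E})/\mathcal{N}^{i-1}(\mathcal{E})=\sum_{J\text{ of type (b)}}\operatorname{Nil}(\mathcal{E}_J)+\sum_{J\text{ of type (a)}}\overline{J}.$$ The series stabilises at $r$ if $\mathcal{N}^r(\mathcal{E})=\mathcal{N}^{r+1}(\mathcal{E})=\cdots$. *)

(* Defs.v *)
From HB Require Import structures.
From mathcomp Require Export all_boot all_order all_algebra sesquilinear.
From mathcomp Require Export boolp classical_sets.
Set Implicit Arguments.
Unset Strict Implicit.
Unset Printing Implicit Defensive.
Import GRing.Theory.
Local Open Scope ring_scope.

(* The sum of an arbitrary (possibly infinite) family of subspaces, i.e. the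
   set of all finite sums of elements of members of the family. *)
Section FamilySum.
Variables (K : fieldType) (V : vectType K).
Implicit Types (P : {vspace V} -> Prop) (U : {vspace V}).

Definition is_family_sum P U : Prop :=
  forall v, v \in U <->
    exists s : seq {vspace V},
      (forall W, W \in s -> P W) /\ v \in (\sum_(W <- s) W)%VS.

Definition family_sum P : {vspace V} := xget 0%VS (is_family_sum P).

Lemma family_sumP P : is_family_sum P (family_sum P).
Proof.
apply: (xgetPex 0%VS); pose Q d := `[< exists s : seq {vspace V},
  (forall W, W \in s -> P W) /\ \dim (\sum_(W <- s) W)%VS = d >].
have Q0 : exists d, Q d.
  by exists 0%N; apply/asboolP; exists [::]; split=> //; rewrite big_nil dimv0.
have Qb d : Q d -> (d <= \dim {:V})%N.
  by move=> /asboolP[s [_ <-]]; rewrite dimvS ?subvf.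
case: (ex_maxnP Q0 Qb) => d /asboolP[s [sP sd]] dmax.
exists (\sum_(W <- s) W)%VS => v; split=> [vs | [t [tP vt]]]; first by exists s.
have Qst : Q (\dim (\sum_(W <- s ++ t) W)%VS).
  apply/asboolP; exists (s ++ t); split=> // W.
  by rewrite mem_cat => /orP[/sP|/tP].
have := dmax _ Qst; rewrite big_cat /= -sd => led.
have /eqP -> : (\sum_(W <- s) W == \sum_(W <- s) W + \sum_(W <- t) W)%VS.
  by rewrite eqEdim addvSl.
by rewrite memvE (subv_trans _ (addvSr _ _)) // -memvE.
Qed.

End FamilySum.

(* Commutative algebras that need not be associative: the multiplication m of
   the algebra is an explicit parameter. A subalgebra A is a subspace of the
   ambient space, and the notions below are relative to A; the whole algebra
   is fullv. *)
Section Algebra.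
Variables (K : fieldType) (V : vectType K) (m : V -> V -> V).
Implicit Types (A I J U W : {vspace V}).

(* For bilinear m, this is the span of all products (see prodsp_sub); same
   definition as prodv in falgebra. *)
Definition prodsp U W : {vspace V} :=
  <<[seq m u w | u <- vbasis U, w <- vbasis W]>>%VS.

(* [:: A^1; ...; A^(k+1)] *)
Fixpoint alg_pows A k : seq {vspace V} :=
  if k is k'.+1 then
    let s := alg_pows A k' in
    rcons s (\sum_(i < k) prodsp (nth 0%VS s i) (nth 0%VS s (k' - i)))%VS
  else [:: A].

(* A^k, meant for k >= 1 only; see alg_pow1 and alg_powS. *)
Definition alg_pow A k : {vspace V} := nth 0%VS (alg_pows A k.-1) k.-1.

(* A^((k)), meant for k >= 1 only. *)
Definition alg_derived A k : {vspace V} := iter k.-1 (fun U => prodsp U U) A.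

Definition nilpotent A : Prop := exists k, (0 < k)%N /\ alg_pow A k = 0%VS.

Definition solvable A : Prop := exists k, (0 < k)%N /\ alg_derived A k = 0%VS.

(* Since m is commutative, one-sided absorption is enough. *)
Definition ideal A I : bool := (I <= A)%VS && (prodsp I A <= I)%VS.

Definition annihilates A u : Prop := u \in A /\ forall v, v \in A -> m u v = 0.

Definition natural_basis A n (e : n.-tuple V) : Prop :=
  basis_of A e /\ forall i j : 'I_n, i != j -> m (tnth e i) (tnth e j) = 0.

Definition evolution A : Prop :=
  (prodsp A A <= A)%VS /\ exists n (e : n.-tuple V), natural_basis A e.

Definition class_T A : Prop :=
  [/\ evolution A, solvable A, ~ nilpotent A & \dim (prodsp A A) = 1%N].

Definition nilpotent_ideal A I : Prop := ideal A I /\ nilpotent I.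

Definition maximal_nilpotent_ideal A I : Prop :=
  nilpotent_ideal A I /\
  forall J, nilpotent_ideal A J -> (I <= J)%VS -> J = I.

(* A maximal nilpotent ideal of A: it always exists (NilP), and it is unique
   when A is in class_T, the only case where Nil is used. *)
Definition Nil A : {vspace V} := xget 0%VS (maximal_nilpotent_ideal A).

Definition supersolvable I : Prop :=
  exists (s : nat) (C : nat -> {vspace V}),
    [/\ C 0%N = 0%VS, C s = I,
        forall i, (i < s)%N -> (C i <= C i.+1)%VS && (C i != C i.+1)
      & forall i, (i <= s)%N -> ideal fullv (C i) /\ \dim (C i) = i].

Definition supersolvable_nilpotent_ideal I : Prop :=
  [/\ ideal fullv I, supersolvable I & nilpotent I].

Lemma size_alg_pows A k : size (alg_pows A k) = k.+1.
Proof. by elim: k => //= k IH; rewrite size_rcons IH. Qed.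

Lemma nth_alg_pows A k i :
  (i <= k)%N -> nth 0%VS (alg_pows A k) i = alg_pow A i.+1.
Proof.
elim: k => [|k IH]; first by rewrite leqn0 => /eqP->.
rewrite leq_eqVlt => /orP[/eqP-> // | ik].
by rewrite /= nth_rcons size_alg_pows ik; apply: IH.
Qed.

Lemma alg_pow1 A : alg_pow A 1 = A. Proof. by []. Qed.

Lemma alg_powS A k : (0 < k)%N ->
  alg_pow A k.+1 =
  (\sum_(1 <= i < k.+1) prodsp (alg_pow A i) (alg_pow A (k.+1 - i)))%VS.
Proof.
case: k => // k _; rewrite /alg_pow /= nth_rcons size_alg_pows ltnn eqxx.
rewrite big_add1 /= big_mkord; apply: eq_bigr => i _; have ik := ltn_ord i.
by rewrite !nth_alg_pows ?leq_subr // subSS subSn.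
Qed.

Lemma NilP A : maximal_nilpotent_ideal A (Nil A).
Proof.
apply: (xgetPex 0%VS).
pose Q d := `[< exists I, nilpotent_ideal A I /\ \dim I = d >].
have Q0 : exists d, Q d.
  exists 0%N; apply/asboolP; exists 0%VS; split; last exact: dimv0.
  split; last by exists 1%N.
  apply/andP; split; first exact: sub0v.
  apply/span_subvP=> _ /allpairsP[[u w] /= [+ _ ->]].
  have -> : (vbasis (0%VS : {vspace V}) : seq V) = [::].
    by apply: size0nil; rewrite size_tuple dimv0.
  by [].
have Qb d : Q d -> (d <= \dim {:V})%N.
  by move=> /asboolP[I [_ <-]]; rewrite dimvS ?subvf.
case: (ex_maxnP Q0 Qb) => d /asboolP[I [In Id]] dmax.
exists I; split=> // J Jn IJ; apply/esym/eqP; rewrite eqEdim IJ Id.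
by apply: dmax; apply/asboolP; exists J.
Qed.

End Algebra.

Lemma prodsp_sub (K : fieldType) (V : vectType K) (m : {bilinear V -> V -> V})
    (U W X : {vspace V}) :
  (prodsp m U W <= X)%VS <-> (forall u w, u \in U -> w \in W -> m u w \in X).
Proof.
split=> [/span_subvP sX u w uU wW | sX]; last first.
  by apply/span_subvP=> _ /allpairsP[[u w] /= [uU wW ->]]; rewrite sX ?vbasis_mem.
rewrite (coord_vbasis uU) (coord_vbasis wW) linear_sumlz memv_suml // => i _.
rewrite linear_sumr memv_suml // => j _.
rewrite linearZl_LR linearZr_LR !memvZ // sX //.
by apply/allpairsP; exists ((vbasis U)`_i, (vbasis W)`_j); rewrite !memt_nth.
Qed.

(* The quotient by an ideal N, carried by a complement of N; quot_proj is the
   canonical projection, with kernel N (quot_proj_eq0), surjective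
   (quot_proj_surj) and multiplicative (quot_projM). *)
Section Quotient.
Variables (K : fieldType) (V : vectType K) (m : V -> V -> V) (N : {vspace V}).

Definition quot : vectType K := subvs_of (N^C)%VS.

Definition quot_proj : 'Hom(V, quot) :=
  linfun (vsproj (N^C)%VS \o (\1 - projv N)%VF).

Definition quot_mul (x y : quot) : quot := quot_proj (m (vsval x) (vsval y)).

Lemma quot_projE v : vsval (quot_proj v) = v - projv N v.
Proof.
have E : (\1 - projv N)%VF v = v - projv N v.
  by rewrite add_lfunE opp_lfunE id_lfunE.
by rewrite lfunE /= E vsprojK // memv_projC.
Qed.

Lemma quot_proj_eq0 v : (quot_proj v == 0) = (v \in N).
Proof.
rewrite -(inj_eq val_inj) /= quot_projE subr_eq0.
by apply/eqP/idP=> [-> | /projv_id-> //]; apply: memv_proj.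
Qed.

Lemma quot_proj_surj x : quot_proj (vsval x) = x.
Proof.
apply: val_inj; rewrite /= quot_projE.
suff /eqP-> : projv N (vsval x) == 0 by rewrite subr0.
by rewrite -memv_ker lker_proj subvsP.
Qed.

End Quotient.

Lemma quot_projM (K : fieldType) (V : vectType K) (m : {bilinear V -> V -> V})
    (N : {vspace V}) (mC : commutative m) (idN : ideal m fullv N) u v :
  quot_proj N (m u v) = quot_mul m (quot_proj N u) (quot_proj N v).
Proof.
have {idN} [_ /(prodsp_sub m) absN] := andP idN.
apply/eqP; rewrite -subr_eq0 -linearB quot_proj_eq0 !quot_projE.
set a := projv N u; set b := projv N v.
have -> : m u v - m (u - a) (v - b) = m a v + m b (u - a).
  rewrite [m (u - a) (v - b)]linearBr [m (u - a) v]linearBl (mC b).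
  set x := m u v; set y := m a v; set z := m (u - a) b.
  by rewrite opprB opprB addrCA [x + _]addrC subrK addrC.
by rewrite memvD // absN ?memvf ?memv_proj.
Qed.

Section Series.
Variables (K : fieldType) (E : vectType K) (m : E -> E -> E).
Variables (n : nat) (e : n.-tuple E).

Definition supp (u : E) : {set 'I_n} := [set i | coord e i u != 0].

Definition supp_space (U : {vspace E}) : {set 'I_n} :=
  [set i | `[< exists u, u \in U /\ i \in supp u >]].

Section Step.
Variable N : {vspace E}.

Definition step_candidate (w : E) : Prop :=
  let J := (<[w]> + N)%VS in
  [/\ ideal m fullv J, \dim J = (1 + \dim N)%N, m w w \in N
    & [disjoint supp w & supp_space N]].

(* J / N, for J = span {w} + N *)
Definition Jbar (w : E) : {vspace quot N} :=
  (quot_proj N @: (<[w]> + N))%VS.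

Definition E_J (w : E) : {vspace quot N} :=
  (\sum_(k in supp w) <[quot_proj N (tnth e k)]>)%VS.

Definition type_a (w : E) : Prop :=
  forall x, x \in Jbar w -> annihilates (quot_mul m (N := N)) fullv x.

Definition type_b (w : E) : Prop :=
  [/\ ideal (quot_mul m (N := N)) fullv (E_J w),
      class_T (quot_mul m (N := N)) (E_J w)
    & Jbar w = prodsp (quot_mul m (N := N)) (E_J w) (E_J w)].

Definition step_summand (W : {vspace quot N}) : Prop :=
  exists2 w, step_candidate w &
    (type_b w /\ W = Nil (quot_mul m (N := N)) (E_J w)) \/
    (type_a w /\ W = Jbar w).

(* The subspace containing N whose quotient by N is the sum of the summands. *)
Definition nil_step : {vspace E} :=
  (quot_proj N @^-1: family_sum step_summand)%VS.

End Step.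

Definition nil_series (i : nat) : {vspace E} := iter i nil_step 0%VS.

Definition stabilises_at (r : nat) : Prop :=
  forall s, (r <= s)%N -> nil_series s = nil_series r.

Lemma nil_series_sub i : (nil_series i <= nil_series i.+1)%VS.
Proof.
apply/subvP=> v vN; rewrite -memv_preim.
have /eqP -> : quot_proj (nil_series i) v == 0 by rewrite quot_proj_eq0.
exact: mem0v.
Qed.

Lemma nil_series_stabilises : exists r, (1 <= r)%N /\ stabilises_at r.
Proof.
pose Q d := `[< exists2 i, (1 <= i)%N & \dim (nil_series i) = d >].
have Q0 : exists d, Q d.
  by exists (\dim (nil_series 1)); apply/asboolP; exists 1%N.
have Qb d : Q d -> (d <= \dim {:E})%N.
  by move=> /asboolP[i _ <-]; rewrite dimvS ?subvf.
case: (ex_maxnP Q0 Qb) => d /asboolP[r r1 rd] dmax; exists r; split=> // s rs.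
have sub : (nil_series r <= nil_series s)%VS.
  rewrite -(subnKC rs); elim: (s - r)%N => [|k IH]; first by rewrite addn0.
  by rewrite addnS (subv_trans IH (nil_series_sub _)).
apply/esym/eqP; rewrite eqEdim sub rd; apply: dmax; apply/asboolP.
by exists s => //; apply: leq_trans rs.
Qed.

End Series.

(* Main.v *)
From HB Require Import structures.
Require Import Defs.
Set Implicit Arguments.
Unset Strict Implicit.
Unset Printing Implicit Defensive.
Import GRing.Theory.
Local Open Scope ring_scope.

(* An ideal I is supersolvable and nilpotent iff it carries a flag of ideals of
   E along which multiplication by I drops one step (nil_flag): I acts on each
   one-dimensional quotient by a scalar, which nilpotency forces to vanish.

   For an ideal N, a one-dimensional candidate w of the next step contributes
   exactly L_w = {x supported in supp w with x w in N}. In type (b) the products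
   in E_J are multiples of w modulo N, so its elements killing w form the
   largest nilpotent ideal; in type (a) every e_k with k in supp w is itself a
   candidate. Distinct candidates interact only through basis vectors whose
   square lies in N, hence the flag of N extends first by the candidates and
   then arbitrarily up to the next term N', and N' acts as required.

   Conversely, an element x of a nilpotent ideal I cannot act on w by a nonzero
   scalar modulo N, so x w lies in N; by induction the part of x carried by
   supp N lies in N for every term N of the series. At the stable term N, walk
   along a flag of I: if v is the first vector outside N, then v minus its part
   on supp N is a candidate for N, and so lies in the next term, N itself. *)

Lemma memv_add_lineP (K : fieldType) (V : vectType K) (U : {vspace V})
    (v x : V) :
  reflect (exists c, x - c *: v \in U) (x \in (U + <[v]>)%VS).
Proof.
apply: (iffP memv_addP) => [[u uU [_ /vlineP[c ->] ->]] | [c xU]].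
  by exists c; rewrite addrK.
by exists (x - c *: v) => //; exists (c *: v); rewrite ?memvZ ?memv_line ?subrK.
Qed.

(** * Flags of ideals and nilpotency *)

Section Nilpotency.
Variables (K : fieldType) (V : vectType K) (m : {bilinear V -> V -> V}).
Hypothesis mC : commutative m.
Implicit Types (A I J U W : {vspace V}) (x y u v : V).

Lemma mem_prodsp U W u w : u \in U -> w \in W -> m u w \in prodsp m U W.
Proof. exact: (prodsp_sub m U W _).1 (subvv _) u w. Qed.

Lemma idealM I u v : ideal m fullv I -> u \in I -> m u v \in I.
Proof. by case/andP=> _ /(prodsp_sub m) + uI; apply; rewrite ?memvf. Qed.

Lemma idealP I : (forall u v, u \in I -> m u v \in I) -> ideal m fullv I.
Proof.
by move=> sI; rewrite /ideal subvf; apply/(prodsp_sub m) => u v /sI.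
Qed.

Lemma mul_alg_pow A k x y : (0 < k)%N ->
  x \in A -> y \in alg_pow m A k -> m x y \in alg_pow m A k.+1.
Proof.
move=> k0 xA yA; rewrite alg_powS // big_ltn // subSS subn0 alg_pow1.
by apply: subvP (addvSl _ _) _ (mem_prodsp _ _).
Qed.

Lemma alg_pow_sub A k : (prodsp m A A <= A)%VS -> (0 < k)%N ->
  (alg_pow m A k <= A)%VS.
Proof.
move=> sA; elim/ltn_ind: k => -[//|[|k] IH] _; first by rewrite alg_pow1.
rewrite alg_powS // big_nat_cond.
elim/big_ind: _ => [||i]; rewrite ?sub0v //.
  by move=> U W sU sW; rewrite subv_add sU.
rewrite andbT => /andP[i0 ik]; apply/prodsp_sub => x y xA yA.
apply: (subvP sA); apply: mem_prodsp.
  exact: subvP (IH _ ik i0) _ xA.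
apply: subvP (IH _ _ _) _ yA; last by rewrite subn_gt0.
by rewrite -(prednK i0) subSS ltnS leq_subr.
Qed.

(* In a product of total degree k >= 2 * k0 one of the factors has degree at
   least k0. *)
Lemma alg_pow_absorb A U W k0 : (prodsp m A A <= A)%VS -> (0 < k0)%N ->
    (forall k, (k0 <= k)%N -> (alg_pow m A k <= U)%VS) ->
    (forall x u, x \in A -> u \in U -> m x u \in W) ->
  forall k, (k0.*2 <= k)%N -> (alg_pow m A k <= W)%VS.
Proof.
move=> sA k0_gt0 powU AU [|k] k0k.
  by rewrite leqn0 double_eq0 -leqn0 leqNgt k0_gt0 in k0k.
case: k k0k => [|k] k0k; first by case: k0 k0_gt0 k0k {powU}.
rewrite alg_powS // big_nat_cond.
elim/big_ind: _ => [||i]; rewrite ?sub0v //.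
  by move=> X Y sX sY; rewrite subv_add sX.
rewrite andbT => /andP[i0 ik]; apply/prodsp_sub => x y xA yA.
have [k0i | ik0] := leqP k0 i.
  rewrite mC; apply: AU; last exact: subvP (powU _ k0i) _ xA.
  by apply: subvP (alg_pow_sub sA _) _ yA; rewrite subn_gt0.
apply: AU; first exact: subvP (alg_pow_sub sA i0) _ xA.
apply: subvP (powU _ _) _ yA.
have ik2 := ltnW ik; rewrite -(leq_add2l i) subnKC //.
by rewrite (leq_trans _ k0k) // -addnn leq_add2r ltnW.
Qed.

(** Solving [x v = c v] modulo [U] for [v] improves membership in A^k + U to membership in A^(k+1) +
    U, until the power of [A] vanishes. This is how nilpotency excludes nonzero eigenvalues. *)
Lemma nilpotent_eigen A U x v c : nilpotent m A -> x \in A ->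
    (forall u, u \in U -> m x u \in U) ->
    v \in (A + U)%VS -> m x v - c *: v \in U -> c != 0 ->
  v \in U.
Proof.
move=> [k [k_gt0 Ak]] xA xU vAU xv c0.
suff : v \in (alg_pow m A k + U)%VS by rewrite Ak add0v.
elim: k k_gt0 {Ak} => // -[|k] IH _ //.
have /memv_addP[p pA [u uU vE]] := IH isT.
have -> : v = c^-1 *: m x p + c^-1 *: (m x u - (m x v - c *: v)).
  rewrite -scalerDr addrA -linearDr -vE opprB addrCA subrr addr0.
  by rewrite scalerA mulVf ?scale1r.
apply: memv_add; apply: memvZ; first exact: mul_alg_pow.
by rewrite memvB ?xU.
Qed.

(** The acting space [I] is kept apart from the top [U] of the flag so that either can be enlarged
    alone; supersolvable nilpotent ideals are the case where the two coincide. *)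
Inductive nil_flag I : {vspace V} -> Prop :=
| NilFlag0 : nil_flag I 0%VS
| NilFlagS U v : nil_flag I U -> v \notin U -> ideal m fullv (U + <[v]>) ->
    (forall x, x \in I -> m x v \in U) -> nil_flag I (U + <[v]>)%VS.

Lemma ideal0 : ideal m fullv 0%VS.
Proof.
by apply: idealP => u v; rewrite memv0 => /eqP->; rewrite linear0l mem0v.
Qed.

Lemma nil_flag_ideal I U : nil_flag I U -> ideal m fullv U.
Proof. by case=> // ; exact: ideal0. Qed.

Lemma dim_add_line U v : v \notin U -> \dim (U + <[v]>) = (\dim U).+1.
Proof.
move=> vU; rewrite dimv_disjoint_sum ?dim_vline.
  by rewrite (_ : v != 0) ?addn1 //; apply: contraNneq vU => ->; apply: mem0v.
apply/eqP; rewrite -subv0; apply/subvP => x /memv_capP[xU /vlineP[c xE]].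
rewrite memv0 xE scaler_eq0; case: eqVneq => //= c0.
by case/negP: vU; rewrite -[v](scalerK c0) memvZ // -xE.
Qed.

Lemma nil_flag_supersolvable I U : nil_flag I U -> supersolvable m U.
Proof.
elim=> [|{}U v _ [s [C [C0 Cs sC iC]]] vU iUv _].
  exists 0%N, (fun=> 0%VS); split=> // i; rewrite leqn0 => /eqP->.
  by rewrite ideal0 dimv0.
have [_ dU] := iC s (leqnn s); rewrite Cs in dU.
exists s.+1, (fun i => if (i <= s)%N then C i else (U + <[v]>)%VS).
split=> [//||i|i] /=; rewrite ?ltnn //.
  rewrite ltnS => is_; have [->|iNs] := eqVneq i s; last first.
    have is1 : (i < s)%N by rewrite ltn_neqAle iNs.
    by rewrite is1 is_ sC.
  rewrite ltnn leqnn Cs addvSl /=; apply: contraNneq vU => ->.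
  by rewrite memvE addvSr.
move=> is1; case: leqP => [/iC //|/(conj is1)/andP/anti_leq->].
by rewrite dim_add_line ?dU.
Qed.

(** Go down the flag: [I] multiplies [U + <[v]>] into [U], so once all high powers of [I] lie in the
    former, [alg_pow_absorb] puts those of doubled exponent in the latter. *)
Lemma nil_flag_nilpotent I : ideal m fullv I -> nil_flag I I -> nilpotent m I.
Proof.
move=> iI flagI.
have sI : (prodsp m I I <= I)%VS.
  by apply/prodsp_sub => x y xI _; apply: idealM.
suff absorb U k : nil_flag I U -> (0 < k)%N ->
    (forall l, (k <= l)%N -> (alg_pow m I l <= U)%VS) -> nilpotent m I.
  by apply: absorb flagI (isT : 0 < 1)%N _ => l; apply: alg_pow_sub.
move=> flagU; elim: flagU k => [|{}U v flagU IH _ iUv Iv] k k0 powU.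
  by exists k; split=> //; apply/eqP; rewrite -subv0 powU.
apply: IH (alg_pow_absorb sI k0 powU _); rewrite ?double_gt0 // => x u xI.
case/memv_add_lineP=> c uU; rewrite -[u](subrK (c *: v)) linearDr linearZr_LR.
by rewrite memvD ?memvZ ?Iv // mC idealM // (nil_flag_ideal flagU).
Qed.

Lemma nil_flag_ssn I : nil_flag I I -> supersolvable_nilpotent_ideal m I.
Proof.
move=> flagI; have iI := nil_flag_ideal flagI.
split=> //; first exact: nil_flag_supersolvable flagI.
exact: nil_flag_nilpotent.
Qed.

(** Each term of the chain is spanned by one vector modulo the previous term, so [x] in [I] acts
    there by a scalar; [nilpotent_eigen] rules out a nonzero one. *)
Lemma ssn_nil_flag I : supersolvable_nilpotent_ideal m I -> nil_flag I I.
Proof.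
case=> iI [s [C [C0 Cs sC iC]]] nI.
have CI : forall i, (i <= s)%N -> (C i <= I)%VS.
  move=> i /subnKC; move: (s - i)%N => d; elim: d i => [|d IH] i.
    by rewrite addn0 -Cs => ->.
  rewrite addnS -addSn => sE; apply: subv_trans (IH _ sE).
  by have /sC/andP[] : (i < s)%N by rewrite -sE addSn ltnS leq_addr.
suff flagC : forall i, (i <= s)%N -> nil_flag I (C i).
  by have := flagC s (leqnn s); rewrite Cs.
elim=> [|i IH] is_; first by rewrite C0; apply: NilFlag0.
have [CS CN] := andP (sC i is_); have [iCi dCi] := iC i (ltnW is_).
have [iCi1 dCi1] := iC i.+1 is_.
have /subvPn[v vC vN] : ~~ (C i.+1 <= C i)%VS.
  by apply: contraNN CN => CS'; apply/eqP/subv_anti; rewrite CS.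
have CE : C i.+1 = (C i + <[v]>)%VS.
  apply/esym/eqP; rewrite eqEdim subv_add CS -memvE vC.
  by rewrite dim_add_line ?dCi ?dCi1 /=.
rewrite CE; apply: NilFlagS => //; first exact/IH/ltnW.
  by rewrite -CE.
move=> x xI; have /memv_add_lineP[c xv] : m x v \in (C i + <[v]>)%VS.
  by rewrite -CE mC idealM.
have [c0 | cN0] := eqVneq c 0; first by rewrite c0 scale0r subr0 in xv.
case/negP: vN; apply: nilpotent_eigen nI xI _ _ xv cN0 => [u uC|].
  by rewrite mC idealM.
by apply: subvP (addvSl _ _) _ (subvP (CI _ is_) _ vC).
Qed.

(** Used to replace the acting ideal by the next term of the series while the flag stays the
    same. *)
Lemma nil_flag_weaken I J U : nil_flag I U ->
    (forall x u, x \in J -> u \in U -> exists2 y, y \in I & m x u = m y u) ->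
  nil_flag J U.
Proof.
elim=> [|{}U v _ IH vU iUv Iv] JI; first exact: NilFlag0.
apply: NilFlagS => // [|x xJ].
  by apply: IH => x u xJ uU; apply: JI xJ (subvP (addvSl _ _) _ uU).
have [y yI ->] := JI x v xJ (subvP (addvSr _ _) _ (memv_line v)); exact: Iv.
Qed.

(** The [vs] may be dependent or meet [U]: a vector already reached is skipped, and the conditions
    on the others survive when [U] grows. *)
Lemma nil_flag_extend I U (vs : seq V) : nil_flag I U ->
    (forall v, v \in vs -> (forall z, m v z \in (U + <[v]>)%VS) /\
                           (forall x, x \in I -> m x v \in U)) ->
  nil_flag I (U + <<vs>>)%VS.
Proof.
elim: vs U => [|v vs IH] U flagU ext; first by rewrite span_nil addv0.
have [vz Iv] := ext v (mem_head _ _); rewrite span_cons addvA.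
apply: IH => [|u uvs]; last first.
  have [uz Iu] := ext u (@mem_behead _ (v :: vs) _ uvs); split=> [z|x xI].
    by apply: subvP (uz z); rewrite addvS ?addvSl.
  exact: subvP (addvSl _ _) _ (Iu x xI).
have [vU | vU] := boolP (v \in U).
  by rewrite (_ : (U + <[v]>)%VS = U) //; apply/addv_idPl; rewrite -memvE.
apply: NilFlagS => //; apply: idealP => u z /memv_add_lineP[c uU].
rewrite -[u](subrK (c *: v)) linearDl linearZl_LR memvD ?memvZ //.
by apply: subvP (addvSl _ _) _ (idealM _ (nil_flag_ideal flagU) uU).
Qed.

End Nilpotency.

(** * Bilinearity and commutativity of the quotient product *)

Section QuotientProduct.
Variables (K : fieldType) (V : vectType K) (m : {bilinear V -> V -> V}).
Variable N : {vspace V}.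

Lemma quot_mul_bilinear : bilinear_for *:%R *:%R (quot_mul m (N := N)).
Proof.
split=> [y a x1 x2 | x a y1 y2]; rewrite /quot_mul.
  by rewrite linearP linearPl linearP.
by rewrite [vsval (_ + _)]linearP linearPr linearP.
Qed.

HB.instance Definition _ := bilinear_isBilinear.Build K
  (quot N) (quot N) (quot N) *:%R *:%R (quot_mul m (N := N)) quot_mul_bilinear.

Lemma quot_mulC : commutative m -> commutative (quot_mul m (N := N)).
Proof. by move=> mC x y; rewrite /quot_mul mC. Qed.

End QuotientProduct.

(** * Coordinates, supports and products in a natural basis *)

Section NaturalBasis.
Variables (K : fieldType) (E : vectType K) (mul : {bilinear E -> E -> E}).
Hypothesis mulC : commutative mul.
Variables (n : nat) (e : n.-tuple E).
Hypothesis eB : natural_basis mul fullv e.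
Implicit Types (I N U : {vspace E}) (x y z u v w : E).
Implicit Types (k : 'I_n) (X Y : {set 'I_n}).

Local Notation sq k := (mul (tnth e k) (tnth e k)).
Local Notation supp := (supp e).
Local Notation cand := (step_candidate mul e).

Lemma mem_supp x k : (k \in supp x) = (coord e k x != 0).
Proof. by rewrite /Defs.supp inE. Qed.

Lemma natural_expand x : x = \sum_k coord e k x *: tnth e k.
Proof.
rewrite {1}(coord_basis eB.1 (memvf x)).
by apply: eq_bigr => k _; rewrite -tnth_nth.
Qed.

Lemma coord_tnth k l : coord e k (tnth e l) = (k == l)%:R.
Proof. by rewrite (tnth_nth 0) coord_free ?(basis_free eB.1) // eq_sym. Qed.

Lemma supp_tnth k : supp (tnth e k) = [set k].
Proof.
apply/setP=> l; rewrite mem_supp coord_tnth inE.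
by case: (l == k); rewrite ?oner_neq0 ?eqxx.
Qed.

Lemma mul_tnth x k : mul x (tnth e k) = coord e k x *: sq k.
Proof.
rewrite {1}(natural_expand x) linear_sumlz (bigD1 k) //= linearZl_LR.
rewrite big1 ?addr0 // => l lk; rewrite linearZl_LR.
by rewrite eB.2 ?scaler0.
Qed.

Lemma mul_expand x y : mul x y = \sum_k (coord e k y * coord e k x) *: sq k.
Proof.
rewrite {1}(natural_expand y) linear_sumr; apply: eq_bigr => k _.
by rewrite linearZr_LR mul_tnth scalerA.
Qed.

Lemma mul_mem U x y :
  (forall k, k \in supp x -> k \in supp y -> sq k \in U) -> mul x y \in U.
Proof.
move=> sqU; rewrite mul_expand memv_suml // => k _.
have [x0 | xN0] := eqVneq (coord e k x) 0.
  by rewrite x0 mulr0 scale0r mem0v.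
have [y0 | yN0] := eqVneq (coord e k y) 0.
  by rewrite y0 mul0r scale0r mem0v.
by rewrite memvZ // sqU ?mem_supp.
Qed.

Lemma mul_disjoint x y : [disjoint supp x & supp y] -> mul x y = 0.
Proof.
move=> dxy; apply/eqP; rewrite -memv0; apply: mul_mem => k kx ky.
by have := disjointFr dxy kx; rewrite ky.
Qed.

Lemma supp_eq0 x : (forall k, k \notin supp x) -> x = 0.
Proof.
move=> x0; rewrite (natural_expand x) big1 // => k _.
by have := x0 k; rewrite mem_supp negbK => /eqP->; rewrite scale0r.
Qed.

Lemma supp_spaceP N k :
  reflect (exists2 u, u \in N & k \in supp u) (k \in supp_space e N).
Proof.
rewrite inE; apply: (iffP (asboolP _)) => [[u [uN ku]] | [u uN ku]].
  by exists u.
by exists u.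
Qed.

Lemma ideal_sq N k : ideal mul fullv N -> k \in supp_space e N -> sq k \in N.
Proof.
move=> iN /supp_spaceP[u uN]; rewrite mem_supp => ku.
by rewrite -[sq k](scalerK ku) memvZ // -mul_tnth idealM.
Qed.

Lemma supp_off_eq0 N x : x \in N -> [disjoint supp x & supp_space e N] -> x = 0.
Proof.
move=> xN dxN; apply: supp_eq0 => k; apply/negP => kx.
by have /negP[] := disjointFr dxN kx; apply/supp_spaceP; exists x.
Qed.

Definition restr X x : E := \sum_(k in X) coord e k x *: tnth e k.

Lemma coord_restr X x k :
  coord e k (restr X x) = if k \in X then coord e k x else 0.
Proof.
rewrite /restr linear_sum /=; case: ifP => kX.
  rewrite (bigD1 k) //= linearZ /= coord_tnth eqxx mulr1 big1 ?addr0 // => l.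
  by case/andP=> _ lk; rewrite linearZ /= coord_tnth eq_sym (negPf lk) mulr0.
rewrite big1 // => l lX; rewrite linearZ /= coord_tnth.
by case: (eqVneq k l) lX => [<-|]; rewrite ?kX ?mulr0.
Qed.

Lemma supp_restr X x : supp (restr X x) = supp x :&: X.
Proof.
apply/setP=> k; rewrite finset.in_setI !mem_supp coord_restr andbC.
by case: ifP; rewrite ?eqxx.
Qed.

Lemma restr_cap x X Y : restr X x = restr (X :&: Y) x + restr (X :\: Y) x.
Proof.
by rewrite /restr (big_setID Y).
Qed.

Lemma restr_supp x w : supp x \subset supp w -> restr (supp w) x = x.
Proof.
move=> xw; rewrite {2}(natural_expand x) /restr [RHS](bigID (mem (supp w))) /=.
rewrite [X in _ = _ + X]big1 ?addr0 // => k kw.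
have : k \notin supp x by apply: contra kw; apply: (fintype.subsetP xw).
by rewrite mem_supp negbK => /eqP->; rewrite scale0r.
Qed.

Lemma restr_mul x w : mul (restr (supp w) x) w = mul x w.
Proof.
rewrite !mul_expand; apply: eq_bigr => k _; rewrite coord_restr mem_supp.
by have [->|] := eqVneq (coord e k w) 0; rewrite ?mul0r.
Qed.

(** * One step of the series *)

Section Candidate.
Variable N : {vspace E}.
Hypothesis iN : ideal mul fullv N.

(** Turns the ideal condition into one on squares of basis vectors: [ideal_sq] extracts them from
    the ideal, and conversely [mul w z] is a combination of the [sq k] with [k] in [supp w]. *)
Lemma candP w : cand N w <->
  [/\ w \notin N, mul w w \in N, [disjoint supp w & supp_space e N]
    & forall k, k \in supp w -> sq k \in (N + <[w]>)%VS].
Proof.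
split=> [[iJ dJ ww dw] | [wN ww dw sqw]].
  split=> // [|k kw].
    apply/negP => wN; move: dJ; rewrite (_ : (_ + N)%VS = N); last first.
      by apply/addv_idPr; rewrite -memvE.
    by move/eqP; rewrite -[X in X == _]add0n eqn_add2r.
  rewrite addvC; apply: (ideal_sq iJ); apply/supp_spaceP; exists w => //.
  by apply: subvP (addvSl _ _) _ (memv_line w).
split=> //; last by rewrite addvC dim_add_line.
rewrite addvC; apply: idealP => u z /memv_add_lineP[c uN].
rewrite -[u](subrK (c *: w)) linearDl linearZl_LR memvD ?memvZ //.
  by apply: subvP (addvSl _ _) _ (idealM _ iN uN).
by apply: mul_mem => k kw _; apply: sqw.
Qed.

Lemma cand_mul w x z : cand N w -> supp x \subset supp w ->
  mul x z \in (N + <[w]>)%VS.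
Proof.
move=> /candP[_ _ _ sqw] xw; apply: mul_mem => k kx _; apply: sqw.
exact: (fintype.subsetP xw).
Qed.

Lemma cand_off w x : cand N w -> supp x \subset supp w -> x \in N -> x = 0.
Proof.
move=> /candP[_ _ dw _] xw xN; apply: (supp_off_eq0 xN).
exact: disjointWl dw.
Qed.

Lemma cand_tnth w k :
  cand N w -> k \in supp w -> sq k \in N -> cand N (tnth e k).
Proof.
move=> cw kw sqk; have [_ _ dw _] := (candP w).1 cw; apply/candP; split=> //.
- apply/negP => /(cand_off cw); rewrite supp_tnth finset.sub1set => /(_ kw).
  by move/(congr1 (coord e k))/eqP; rewrite coord_tnth linear0 eqxx oner_eq0.
- by apply: disjointWl dw; rewrite supp_tnth finset.sub1set.
- move=> l; rewrite supp_tnth => /set1P->.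
  by apply: subvP (addvSl _ _) _ sqk.
Qed.

(** Modulo [N], [sq k] is a multiple of both [w] and [w']. If both coefficients are nonzero, a
    relation between [w] and [w'] holds modulo [N]; as both supports avoid that of [N], it holds
    exactly. *)
Lemma cand_meet w w' k :
    cand N w -> cand N w' -> k \in supp w -> k \in supp w' ->
  sq k \in N \/ exists2 c, c != 0 & w' = c *: w.
Proof.
move=> cw cw' kw kw'; have [_ _ dw sqw] := (candP w).1 cw.
have [_ _ dw' sqw'] := (candP w').1 cw'.
have [a aN] := memv_add_lineP _ _ _ (sqw k kw).
have [b bN] := memv_add_lineP _ _ _ (sqw' k kw').
have [b0|b0] := eqVneq b 0; first by left; rewrite b0 scale0r subr0 in bN.
have [a0|a0] := eqVneq a 0; first by left; rewrite a0 scale0r subr0 in aN.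
right; exists (b^-1 * a); first by rewrite mulf_neq0 ?invr_eq0.
have abN : b *: w' - a *: w \in N.
  by have := memvB aN bN; rewrite opprB addrC addrA subrK.
suff : b *: w' - a *: w = 0.
  by move/eqP; rewrite subr_eq0 -scalerA => /eqP<-; rewrite scalerK.
apply: (supp_off_eq0 abN); apply/pred0P => l /=; apply/negbTE/negP.
case/andP=> ls lN; move: ls; rewrite mem_supp linearB !linearZ /=.
have := disjointFl dw lN; have := disjointFl dw' lN.
by rewrite !mem_supp => /negbFE/eqP-> /negbFE/eqP->; rewrite !mulr0 subrr eqxx.
Qed.

(** * The algebras [E_J] in the quotient, and generators of the next term *)

Local Notation pi := (quot_proj N).
Local Notation qm := (quot_mul mul (N := N)).
Local Notation EJ := (E_J e N).

Lemma piM x y : pi (mul x y) = qm (pi x) (pi y).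
Proof. exact: quot_projM. Qed.

Lemma pi_eq0 x : x \in N -> pi x = 0.
Proof. by rewrite -quot_proj_eq0 => /eqP. Qed.

Lemma pi_line w x : x \in (N + <[w]>)%VS -> pi x \in <[pi w]>%VS.
Proof.
case/memv_add_lineP=> c /pi_eq0/eqP; rewrite linearB linearZ subr_eq0 => /eqP->.
by rewrite memvZ ?memv_line.
Qed.

Lemma JbarE w : Jbar N w = <[pi w]>%VS.
Proof.
rewrite /Jbar limgD limg_line; apply/addv_idPl/subvP => _ /memv_imgP[x xN ->].
by rewrite pi_eq0 ?mem0v.
Qed.

Lemma E_JP w (y : quot N) :
  y \in EJ w <-> exists2 x, supp x \subset supp w & y = pi x.
Proof.
split=> [/memv_sumP[vs vsE ->] | [x xw ->]].
  pose P (y : quot N) := exists2 x, supp x \subset supp w & y = pi x.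
  apply: (big_ind P) => [|_ _ [x1 xw1 ->] [x2 xw2 ->]|k kw].
  - exists 0; last by rewrite linear0.
    by apply/fintype.subsetP => k; rewrite mem_supp linear0 eqxx.
  - exists (x1 + x2); last by rewrite linearD.
    apply/fintype.subsetP => k; apply: contraTT => kw.
    have := contra (fintype.subsetP xw1 k) kw.
    have := contra (fintype.subsetP xw2 k) kw.
    by rewrite !mem_supp linearD !negbK /= => /eqP-> /eqP->; rewrite addr0.
  - have /vlineP[c ->] := vsE k kw.
    exists (c *: tnth e k); last by rewrite linearZ.
    apply/fintype.subsetP => l; rewrite mem_supp linearZ /= coord_tnth.
    by have [->|] := eqVneq l k; rewrite ?mulr0 ?eqxx.
rewrite -(restr_supp xw) linear_sum memv_suml // => k kw.
by rewrite linearZ memvZ //; apply: subvP (memv_line _); apply: (sumv_sup k).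
Qed.

Lemma E_J_tnth w k : k \in supp w -> pi (tnth e k) \in EJ w.
Proof.
by move=> kw; apply/E_JP; exists (tnth e k); rewrite ?supp_tnth ?finset.sub1set.
Qed.

Lemma E_J_gen w : pi w \in EJ w.
Proof. by apply/E_JP; exists w. Qed.

Lemma E_J_mul w (y z : quot N) :
  cand N w -> y \in EJ w -> qm y z \in <[pi w]>%VS.
Proof.
move=> cw /E_JP[x xw ->]; rewrite -(quot_proj_surj z) -piM.
exact/pi_line/cand_mul.
Qed.

Lemma E_J_mul_sub w (y z : quot N) : cand N w -> y \in EJ w -> qm y z \in EJ w.
Proof.
by move=> cw yw; apply: subvP (E_J_mul z cw yw); rewrite -memvE E_J_gen.
Qed.

(** [y] acts on [pi w] by a scalar. Were it nonzero, the ideal [Nil] would contain [pi w], and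
    [nilpotent_eigen] would force [pi w = 0]. *)
Lemma Nil_E_J_annihilates w (y : quot N) :
  cand N w -> y \in Nil qm (EJ w) -> qm y (pi w) = 0.
Proof.
move=> cw yNil; have [[iT nT] _] := NilP qm (EJ w).
move/andP: iT => [TE /(prodsp_sub qm) TT].
have /vlineP[c yw] := E_J_mul (pi w) cw (subvP TE _ yNil).
have [c0 | c0] := eqVneq c 0; first by rewrite yw c0 scale0r.
have [/negP[]] := (candP w).1 cw; rewrite -quot_proj_eq0 -memv0.
apply: (nilpotent_eigen nT yNil _ _ _ c0).
- by move=> u; rewrite memv0 => /eqP->; rewrite linear0r mem0v.
- by rewrite addv0 -[pi w](scalerK c0) memvZ // -yw TT ?E_J_gen.
- by rewrite /= yw subrr mem0v.
Qed.

Lemma pi_sqr0 w : cand N w -> qm (pi w) (pi w) = 0.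
Proof. by case/candP=> _ ww _ _; rewrite -piM pi_eq0. Qed.

(** The elements of [E_J] killing [pi w] form a nilpotent ideal [M], which contains [Nil] by
    [Nil_E_J_annihilates]; maximality gives equality. *)
Lemma mem_Nil_E_J w x : cand N w -> supp x \subset supp w ->
  mul x w \in N -> pi x \in Nil qm (EJ w).
Proof.
move=> cw xw xwN.
pose M := (EJ w :&: lker (linfun (applyr qm (pi w))))%VS.
have memM (y : quot N) : y \in M = (y \in EJ w) && (qm y (pi w) == 0).
  by rewrite memv_cap memv_ker [linfun _ y]lfunE.
have ME : (M <= EJ w)%VS := capvSl _ _.
have wM : (<[pi w]> <= M)%VS by rewrite -memvE memM E_J_gen (pi_sqr0 cw) eqxx.
have [[iT nT] maxT] := NilP qm (EJ w).
suff <- : M = Nil qm (EJ w).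
  by rewrite memM -piM (pi_eq0 xwN) eqxx andbT; apply/E_JP; exists x.
apply: maxT; last first.
  apply/subvP => y yT; rewrite memM Nil_E_J_annihilates // eqxx andbT.
  by have /andP[/subvP TE _] := iT; apply: TE.
have MM : (prodsp qm M M <= M)%VS.
  apply/prodsp_sub => y z yM _; apply: (subvP wM).
  exact/E_J_mul/(subvP ME).
split.
  apply/andP; split=> //; apply/prodsp_sub => y z yM _; apply: (subvP wM).
  exact/E_J_mul/(subvP ME).
(* Products in [M] lie on the line of [pi w], which [M] kills; each use of [alg_pow_absorb] doubles
   the exponent, from 1 to 2 to 4. *)
exists 4; split=> //; apply/eqP; rewrite -subv0.
have pow2 (k : nat) : (1.*2 <= k)%N -> (alg_pow qm M k <= <[pi w]>)%VS.
  apply: (alg_pow_absorb (quot_mulC mulC) MM (U := M)) => // [l|y z yM _].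
    exact: alg_pow_sub.
  exact/E_J_mul/(subvP ME).
apply: (alg_pow_absorb (quot_mulC mulC) MM _ pow2) => // y _ yM /vlineP[c ->].
move: yM; rewrite memM => /andP[_ /eqP y0].
by rewrite linearZr_LR /= y0 scaler0 mem0v.
Qed.

(** Both kinds of summands lift to the same generators: by [Nil_E_J_annihilates] in type (b), and as
    multiples of [w] in type (a). *)
Lemma nil_step_ind (P : E -> Prop) :
    (forall x y, P x -> P y -> P (x + y)) -> (forall x, x \in N -> P x) ->
    (forall w x, cand N w -> supp x \subset supp w -> mul x w \in N -> P x) ->
  forall x, x \in nil_step mul e N -> P x.
Proof.
move=> PD PN Pgen x; rewrite -memv_preim => /family_sumP[s [sP xs]].
elim: s x sP xs => [|W s IH] x sP.
  by rewrite big_nil memv0 quot_proj_eq0 => /PN.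
rewrite big_cons => /memv_addP[y yW [z zs xyz]].
have Pz : P (vsval z).
  apply: IH; rewrite ?quot_proj_surj // => U Us; apply: sP.
  by rewrite inE Us orbT.
have [w cw Ww] := sP W (mem_head _ _).
have [u uw yu] : exists2 u, supp u \subset supp w /\ mul u w \in N & y = pi u.
  case: Ww => [[_ WE] | [_ WE]]; rewrite WE in yW.
    have [[/andP[/subvP TE _] _] _] := NilP qm (EJ w).
    have [u uw yu] := (E_JP w y).1 (TE _ yW); exists u => //; split=> //.
    by rewrite -quot_proj_eq0 piM -yu Nil_E_J_annihilates.
  rewrite JbarE in yW; have [c ->] := vlineP _ _ yW.
  exists (c *: w); last by rewrite linearZ.
  have [_ ww _ _] := (candP w).1 cw; split; last by rewrite linearZl_LR memvZ.
  apply/fintype.subsetP => k.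
  by rewrite !mem_supp linearZ /= mulf_eq0 negb_or => /andP[].
have [uw1 uw2] := uw; have Pu : P u by apply: Pgen cw uw1 uw2.
rewrite -[x](subrK (u + vsval z)); apply: (PD); last exact: PD.
apply: PN; rewrite -quot_proj_eq0 linearB linearD /= -yu quot_proj_surj xyz.
by rewrite subrr.
Qed.

Lemma nil_step_summand W x : step_summand mul e W -> pi x \in W ->
  x \in nil_step mul e N.
Proof.
move=> sW xW; rewrite -memv_preim; apply/family_sumP; exists [:: W].
by split; rewrite ?big_seq1 // => U /[!inE]/eqP->.
Qed.

Lemma type_a_sq w : cand N w -> (forall k, k \in supp w -> sq k \in N) ->
  type_a mul N w.
Proof.
move=> cw sqN y; rewrite JbarE => /vlineP[c ->]; split=> [|z _].
  exact: memvf.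
rewrite linearZl_LR /= -(quot_proj_surj z) -piM pi_eq0 ?scaler0 //.
by apply: mul_mem => k /sqN.
Qed.

(** * Candidates of type (b) *)

Section TypeB.
Variables (w : E) (k0 : 'I_n).
Hypotheses (cw : cand N w) (k0w : k0 \in supp w) (sqk0 : sq k0 \notin N).

Lemma pi_sq0 : exists2 c, c != 0 & pi (sq k0) = c *: pi w.
Proof.
have [_ _ _ sqw] := (candP w).1 cw.
have /vlineP[c sqE] := pi_line (sqw _ k0w); exists c => //.
by apply: contraNneq sqk0 => c0; rewrite -quot_proj_eq0 sqE c0 scale0r.
Qed.

Lemma prodsp_E_J : prodsp qm (EJ w) (EJ w) = <[pi w]>%VS.
Proof.
apply/subv_anti/andP; split.
  by apply/prodsp_sub => y z yw _; apply: E_J_mul.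
have [c c0 sqE] := pi_sq0; rewrite -memvE -[pi w](scalerK c0) -sqE piM memvZ //.
by rewrite mem_prodsp ?E_J_tnth.
Qed.

Lemma natural_basis_E_J :
  natural_basis qm (EJ w) [tuple pi (tnth e (enum_val i)) | i < #|supp w|].
Proof.
split=> [|i j ij]; last first.
  by rewrite !tnth_mktuple -piM eB.2 ?linear0 // (inj_eq enum_val_inj).
set b := [tuple _ | _ < _]; apply/andP; split.
  apply/eqP/subv_anti/andP; split.
    by apply/span_subvP => _ /mapP[i _ ->]; apply/E_J_tnth/enum_valP.
  apply/subv_sumP => k kw; rewrite -memvE memv_span //; apply/mapP.
  by exists (enum_rank_in kw k); rewrite ?mem_enum ?enum_rankK_in.
apply/freeP => a a0 i.
(* The relation lifts to a vector supported in [supp w] and lying in [N], hence zero; its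
   coordinates are the coefficients [a]. *)
pose x := \sum_j a j *: tnth e (enum_val j).
have coordx l : coord e l x = \sum_(j | enum_val j == l) a j.
  rewrite linear_sum [RHS]big_mkcond /=; apply: eq_bigr => j _.
  by rewrite linearZ /= coord_tnth eq_sym; case: eqP; rewrite ?mulr1 ?mulr0.
have x0 : x = 0.
  apply: (cand_off cw); last first.
    rewrite -quot_proj_eq0 linear_sum -[X in _ == X]a0; apply/eqP.
    by apply: eq_bigr => j _; rewrite linearZ -(tnth_nth 0 b) tnth_mktuple.
  apply/fintype.subsetP => l; apply: contraTT => lw.
  rewrite mem_supp negbK coordx.
  by rewrite big_pred0 // => j; apply: contraNF lw => /eqP<-; apply: enum_valP.
have := coordx (enum_val i); rewrite x0 linear0 (big_pred1 i) // => j.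
by rewrite (inj_eq enum_val_inj).
Qed.

Lemma class_T_E_J : class_T qm (EJ w).
Proof.
have wN : pi w != 0 by rewrite quot_proj_eq0; case/candP: cw.
split; last by rewrite prodsp_E_J dim_vline wN.
- split; first by rewrite prodsp_E_J -memvE E_J_gen.
  by eexists; eexists; apply: natural_basis_E_J.
(* The derived terms, numbered from 1, are [E_J], the line of [pi w], and 0. *)
- exists 3; split=> //; rewrite /alg_derived /iter /= prodsp_E_J.
  apply/eqP; rewrite -subv0.
  apply/prodsp_sub => _ _ /vlineP[a ->] /vlineP[b ->].
  by rewrite linearZl_LR linearZr_LR /= (pi_sqr0 cw) !scaler0 mem0v.
move=> nE; case/negP: wN; rewrite -memv0.
have [c c0 sqE] := pi_sq0.
(* The image of [tnth e k0] has [pi w] as an eigenvector with this nonzero eigenvalue. *)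
apply: (nilpotent_eigen (c := coord e k0 w * c) nE (E_J_tnth k0w)).
- by move=> u; rewrite memv0 => /eqP->; rewrite linear0r mem0v.
- by rewrite addv0 E_J_gen.
- by rewrite /= -piM mulC mul_tnth linearZ /= sqE scalerA subrr mem0v.
- by rewrite mulf_neq0 // -mem_supp.
Qed.

Lemma type_b_sq : type_b mul e N w.
Proof.
split; last by rewrite JbarE prodsp_E_J.
  by apply: idealP => y z; apply: E_J_mul_sub.
exact: class_T_E_J.
Qed.

End TypeB.

(** If some [sq k] with [k] in [supp w] leaves [N], then [w] is of type (b) and [mem_Nil_E_J]
    applies. Otherwise each such [tnth e k] is a candidate of type (a), and [x] is a combination of
    them. *)
Lemma mem_nil_step w x : cand N w -> supp x \subset supp w -> mul x w \in N ->
  x \in nil_step mul e N.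
Proof.
move=> cw xw xwN.
have [/existsP[k0 /andP[k0w sqk0]] | ] :=
    boolP [exists k, (k \in supp w) && (sq k \notin N)].
  apply: nil_step_summand (mem_Nil_E_J cw xw xwN).
  by exists w => //; left; split=> //; apply: type_b_sq cw k0w sqk0.
move=> noB; have sqN k : k \in supp w -> sq k \in N.
  by move=> kw; apply: contraNT noB => sqk; apply/existsP; exists k; rewrite kw.
rewrite -(restr_supp xw) memv_suml // => k kw; rewrite memvZ //.
have ck := cand_tnth cw kw (sqN k kw).
apply: (nil_step_summand (W := Jbar N (tnth e k))); last first.
  by rewrite JbarE memv_line.
exists (tnth e k) => //; right; split=> //; apply: type_a_sq => // l.
by rewrite supp_tnth => /set1P->; apply: sqN.
Qed.

(** * Action and support of the next term *)

Lemma mem_nil_step_cand w : cand N w -> w \in nil_step mul e N.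
Proof. by move=> cw; apply: (mem_nil_step cw) => //; case/candP: cw. Qed.

Lemma sub_nil_step : (N <= nil_step mul e N)%VS.
Proof.
by apply/subvP => x xN; rewrite -memv_preim (pi_eq0 xN) mem0v.
Qed.

(** For a generator attached to [w'], a shared basis vector with square outside [N] makes [w]
    proportional to [w']; otherwise [mul x w] only involves squares in [N]. *)
Lemma nil_step_mul_cand x w :
  x \in nil_step mul e N -> cand N w -> mul x w \in N.
Proof.
move=> + cw; move: x; apply: nil_step_ind => [x y xN yN|x xN|w' x cw' xw' xN].
- by rewrite linearDl memvD.
- exact: idealM.
have [/existsP[k /and3P[kw kw' sqk]]|noM] :=
    boolP [exists k, [&& k \in supp w, k \in supp w' & sq k \notin N]].
  have [sqN | [c c0 ->]] := cand_meet cw' cw kw' kw.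
    by rewrite sqN in sqk.
  by rewrite linearZr_LR memvZ.
apply: mul_mem => k kx kw; apply: contraNT noM => sqk; apply/existsP; exists k.
by rewrite kw sqk (fintype.subsetP xw').
Qed.

Lemma supp_nil_step k : k \in supp_space e (nil_step mul e N) ->
  k \in supp_space e N \/ exists2 w, cand N w & k \in supp w.
Proof.
case/supp_spaceP => x; move: x.
apply: nil_step_ind => [x y IHx IHy|x xN kx|w x cw xw _ kx].
- have [kx | kx] := boolP (k \in supp x); first by move=> _; apply: IHx.
  rewrite mem_supp linearD /=; move: kx; rewrite mem_supp negbK => /eqP->.
  by rewrite add0r -mem_supp; apply: IHy.
- by left; apply/supp_spaceP; exists x.
- by right; exists w => //; apply: (fintype.subsetP xw).
Qed.

(** Candidates may be infinite in number, but one per basis index covers all their supports. *)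
Lemma cand_cover : exists2 ws : seq E, (forall w, w \in ws -> cand N w) &
  forall k, (exists2 w, cand N w & k \in supp w) ->
    has (fun w => k \in supp w) ws.
Proof.
have /choice[f fP] (k : 'I_n) : exists w,
    (exists2 w, cand N w & k \in supp w) -> cand N w /\ k \in supp w.
  have [[w cw kw]|noC] := EM (exists2 w, cand N w & k \in supp w).
    by exists w.
  by exists 0.
pose T := [set k | `[< exists2 w, cand N w & k \in supp w >]].
exists [seq f k | k <- enum T] => [_ /mapP[k + ->]|k kT].
  by rewrite mem_enum inE => /asboolP/fP[].
apply/hasP; exists (f k); last by case: (fP k kT).
by apply: map_f; rewrite mem_enum inE; apply/asboolP.
Qed.

Lemma nil_flag_nil_step :
  nil_flag mul N N -> nil_flag mul (nil_step mul e N) (nil_step mul e N).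
Proof.
set N' := nil_step mul e N => flagN.
(* A generator attached to a candidate is supported off [supp_space e N], so it annihilates [N]. *)
have N'N x u : x \in N' -> u \in N -> exists2 y, y \in N & mul x u = mul y u.
  move=> + uN; move: x.
  apply: nil_step_ind => [x y [x' xN xE] [y' yN yE]|x xN|w x cw xw _].
  - by exists (x' + y'); rewrite ?memvD // !linearDl xE yE.
  - by exists x.
  exists 0; rewrite ?mem0v // linear0l mul_disjoint //.
  have [_ _ dw _] := (candP w).1 cw; apply: disjointWl xw _.
  apply: disjointWr dw; apply/fintype.subsetP => k ku.
  by apply/supp_spaceP; exists u.
have [ws wsc wscov] := cand_cover.
have flag1 : nil_flag mul N' (N + <<ws>>)%VS.
  apply: (nil_flag_extend (nil_flag_weaken flagN N'N)) => w /wsc cw.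
  split=> [z|x xN']; first exact: cand_mul.
  exact: nil_step_mul_cand.
(* This middle term contains the squares of all basis vectors in the support of [N'], so above it
   vectors can be added in any order. *)
have N'E v z : v \in N' -> mul v z \in (N + <<ws>>)%VS.
  move=> vN'; apply: mul_mem => k kv _.
  have kN' : k \in supp_space e N' by apply/supp_spaceP; exists v.
  have [kN | kN] := supp_nil_step kN'.
    by apply: subvP (addvSl _ _) _ (ideal_sq iN kN).
  have /hasP[w ws_w kw] := wscov k kN.
  have [_ _ _ sqw] := (candP w).1 (wsc w ws_w).
  by apply: subvP (sqw k kw); rewrite addvS // -memvE memv_span.
have N'D : (N + <<ws>> + <<vbasis N'>>)%VS = N'.
  rewrite (span_basis (vbasisP N')); apply/addv_idPr.
  rewrite subv_add sub_nil_step; apply/span_subvP => w /wsc.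
  exact: mem_nil_step_cand.
rewrite -{2}N'D.
apply: nil_flag_extend flag1 _ => v /vbasis_mem vN'; split=> [z|x xN'].
  by apply: subvP (addvSl _ _) _ (N'E v z vN').
by rewrite mulC N'E.
Qed.

(** Off the support of [N], the support of the next term is a finite union of candidate supports,
    which are added one at a time. *)
Lemma restr_nil_step x : (forall w, cand N w -> mul x w \in N) ->
    restr (supp_space e N) x \in N ->
  restr (supp_space e (nil_step mul e N)) x \in nil_step mul e N.
Proof.
set N' := nil_step mul e N => xcand xN.
have [ws wsc wscov] := cand_cover.
rewrite (restr_cap _ _ (supp_space e N)).
have -> : supp_space e N' :&: supp_space e N = supp_space e N.
  apply/finset.setIidPr/fintype.subsetP => k /supp_spaceP[u uN ku].
  by apply/supp_spaceP; exists u => //; apply: subvP sub_nil_step _ uN.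
apply: memvD; first exact: subvP sub_nil_step _ xN.
pose X (ws : seq E) := [set k | has (fun w => k \in supp w) ws].
have -> : supp_space e N' :\: supp_space e N = X ws.
  apply/setP => k; rewrite inE [in RHS]inE; apply/andP/idP.
    by case=> kN /supp_nil_step[kN1|/wscov//]; rewrite kN1 in kN.
  case/hasP => w /wsc cw kw; split; last first.
    by apply/supp_spaceP; exists w => //; apply: mem_nil_step_cand.
  by have [_ _ dw _] := (candP w).1 cw; rewrite (disjointFr dw kw).
elim: ws wsc {wscov} => [|w ws IH] wsc.
  by rewrite /restr big_pred0 ?mem0v // => k; rewrite inE.
have XN' : restr (X ws) x \in N'.
  by apply: IH => u uws; apply: wsc; rewrite inE uws orbT.
have cw : cand N w by apply: wsc; rewrite mem_head.
have -> : restr (X (w :: ws)) x = restr (X ws) x + restr (supp w :\: X ws) x.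
  rewrite (restr_cap _ _ (X ws)); congr (restr _ x + restr _ x).
    by apply/setP => k; rewrite !inE /=; case: (has _ _); rewrite ?orbT ?andbF.
  by apply/setP => k; rewrite !inE -mem_supp /=; case: (has _ _); rewrite ?orbF.
rewrite memvD //.
(* An index shared with an earlier candidate and with square outside [N] makes the two proportional,
   so [w] brings no new index. *)
have [/existsP[k /and3P[kw kX sqk]]|noX] :=
    boolP [exists k, [&& k \in supp w, k \in X ws & sq k \notin N]].
  move: kX; rewrite inE => /hasP[w' w'ws kw'].
  have cw' : cand N w' by apply: wsc; rewrite inE w'ws orbT.
  have [sqN | [c c0 wE]] := cand_meet cw cw' kw kw'.
    by rewrite sqN in sqk.
  rewrite /restr big_pred0 ?mem0v // => l.
  apply/negP; rewrite finset.in_setD inE => /andP[/hasP lX lw]; apply: lX.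
  by exists w' => //; rewrite wE mem_supp linearZ /= mulf_neq0 // -mem_supp.
(* The new part is the restriction to [supp w] minus the overlap. The former has the same product
   with [w] as [x]; in the latter each basis vector has its square in [N]. Hence [mem_nil_step]
   covers both. *)
rewrite -[restr _ x](addKr (restr (supp w :&: X ws) x)) -restr_cap addrC.
rewrite memvB //.
  apply: (mem_nil_step cw); first by rewrite supp_restr finset.subsetIr.
  by rewrite restr_mul xcand.
rewrite memv_suml // => k /finset.setIP[kw kX]; rewrite memvZ //.
apply: (mem_nil_step cw); first by rewrite supp_tnth finset.sub1set.
rewrite mulC mul_tnth memvZ //; apply: contraNT noX => sqk.
by apply/existsP; exists k; rewrite kw kX.
Qed.

Lemma nilpotent_ideal_mul_cand I x w :
  ideal mul fullv I -> nilpotent mul I -> x \in I -> cand N w -> mul x w \in N.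
Proof.
move=> iI nI xI cw; have [wN _ _ _] := (candP w).1 cw.
have [c xw] : exists c, mul x w - c *: w \in N.
  by apply/memv_add_lineP; rewrite mulC cand_mul.
have [c0 | c0] := eqVneq c 0; first by rewrite c0 scale0r subr0 in xw.
case/negP: wN; apply: (nilpotent_eigen nI xI _ _ xw c0) => [u uN|].
  by rewrite mulC idealM.
(* Modulo [N], [c *: w] equals [mul x w], which is in [I]; this puts [w] in [I + N]. *)
rewrite -[w](scalerK c0) memvZ // -[c *: w](subKr (mul x w)).
by rewrite memv_add ?memvN // idealM.
Qed.

Lemma nil_flag_sub_fixed I U : nil_step mul e N = N -> ideal mul fullv I ->
    (forall x, x \in I -> restr (supp_space e N) x \in N) ->
  nil_flag mul I U -> (U <= I)%VS -> (U <= N)%VS.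
Proof.
move=> fixN iI restrN; elim=> [|{}U v flagU IH _ iUv Iv].
  by rewrite !sub0v.
rewrite !subv_add -!memvE => /andP[UI vI]; rewrite IH //=.
have {}IH := subvP (IH UI); apply/negP => /negP vN.
have vSN := restrN v vI; set vS := restr _ v in vSN; pose v' := v - vS.
have suppv' k : (k \in supp v') = (k \in supp v) && (k \notin supp_space e N).
  rewrite !mem_supp linearB /= coord_restr.
  by case: ifP; rewrite ?subrr ?eqxx ?andbF ?subr0 ?andbT.
have v'N : v' \notin N.
  by apply: contra vN => v'N; rewrite -[v](subrK vS) memvD.
have cv' : cand N v'.
  apply/candP; split=> //.
  (* As [v] is in [I], [mul v v] drops into [U], hence into [N]; every other product has the factor
     [vS] from [N]. *)
  - rewrite {1}/v' linearBl; apply: memvB; last exact: idealM.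
    rewrite linearBr; apply: memvB; first exact/IH/Iv.
    by rewrite mulC idealM.
  - apply/pred0P => k /=; rewrite suppv'.
    by case: (k \in supp_space _ _); rewrite ?andbF.
  move=> k; rewrite suppv' => /andP[kv _].
  (* Replacing [v] by [v'] in this relation costs [c *: vS], which is in [N], as is [U]. *)
  have /memv_add_lineP[c sqk] : sq k \in (U + <[v]>)%VS.
    apply: ideal_sq => //; apply/supp_spaceP; exists v => //.
    by rewrite (subvP (addvSr _ _)) ?memv_line.
  apply/memv_add_lineP; exists c; rewrite scalerBr opprB addrCA addrC.
  by rewrite memvD ?memvZ // IH.
by have := mem_nil_step_cand cv'; rewrite fixN (negPf v'N).
Qed.

End Candidate.

(** * All terms of the series, and the stable one *)

Lemma nil_series_flag i :
  nil_flag mul (nil_series mul e i) (nil_series mul e i).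
Proof.
elim: i => [|i IH]; first exact: NilFlag0.
exact: nil_flag_nil_step (nil_flag_ideal IH) IH.
Qed.

Lemma restr_nil_series I x i :
  ideal mul fullv I -> nilpotent mul I -> x \in I ->
  restr (supp_space e (nil_series mul e i)) x \in nil_series mul e i.
Proof.
move=> iI nI xI; elim: i => [|i IH].
  rewrite /restr big_pred0 ?mem0v // => k; apply/supp_spaceP => -[u].
  by rewrite memv0 => /eqP->; rewrite mem_supp linear0 eqxx.
have iN := nil_flag_ideal (nil_series_flag i).
by apply: restr_nil_step => // w; apply: nilpotent_ideal_mul_cand iI nI xI.
Qed.

End NaturalBasis.

Theorem theorem3p14 (K : fieldType) (charK : 2%N \notin [pchar K])
    (E : vectType K) (mul : {bilinear E -> E -> E}) (mulC : commutative mul)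
    (n : nat) (e : n.-tuple E) (eB : natural_basis mul fullv e)
    (r : nat) (r_ge1 : (1 <= r)%N) (stab : stabilises_at mul e r) :
  supersolvable_nilpotent_ideal mul (nil_series mul e r) /\
  (forall I : {vspace E},
     supersolvable_nilpotent_ideal mul I -> (I <= nil_series mul e r)%VS).
Proof.
have flagN := nil_series_flag mulC eB r; have iN := nil_flag_ideal flagN.
split=> [|I ssI]; first exact: nil_flag_ssn.
have [iI _ nI] := ssI; have flagI := ssn_nil_flag mulC ssI.
apply: (nil_flag_sub_fixed mulC eB iN _ iI _ flagI) => //.
  (* Stability at [r] makes the [r]-th term a fixed point of [nil_step]. *)
  exact: (stab r.+1).
by move=> x xI; apply: restr_nil_series iI nI xI.
Qed.
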